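(* Let $N\ge2$, $p\in[1,\infty)$ and $\mathcal X=\mathbb{R}^N$. There exist $\mathbb X,\mathbb Y\in\mathrm{FP}_p$ with $\mathbb X\sim_{N-2}\mathbb Y$ and a bounded, continuous, non-anticipative function $c:\mathcal X\times\{1,\dots,N\}\to\mathbb{R}$ such that $v_c(\mathbb X)\ne v_c(\mathbb Y)$, where $$v_c(\mathbb X):=\inf\{\mathbb{E}[c_\tau(X)]:\tau\text{ is an }(\mathcal{F}^{\mathbb X}_t)_{t=1}^N\text{-stopping time with values in }\{1,\dots,N\}\}.$$
   Context: A filtered process is a tuple $\mathbb{X}=(\Omega^{\mathbb X},\mathcal{F}^{\mathbb X},\mathbb{P}^{\mathbb X},(\mathcal{F}^{\mathbb X}_t)_{t=1}^N,(X_t)_{t=1}^N)$ consisting of a probability space, a filtration on it, and a real-valued process $X=(X_t)_{t=1}^N$ adapted to the filtration. $\mathcal{FP}_p$ is the class of all filtered processes with $\mathbb{E}[\sum_{t=1}^N|X_t|^p]<\infty$. A coupling of $\mathbb X,\mathbb Y$ is a probability $\pi$ on $(\Omega^{\mathbb X}\times\Omega^{\mathbb Y},\mathcal{F}^{\mathbb X}\otimes\mathcal{F}^{\mathbb Y})$ with marginals $\mathbb{P}^{\mathbb X},\mathbb{P}^{\mathbb Y}$. It is causal from $\mathbb X$ to $\mathbb Y$ if, for every $1\le t\le N$, under $\pi$ the $\sigma$-algebras $\mathcal{F}^{\mathbb X}_N$ and $\mathcal{F}^{\mathbb Y}_t$ (viewed on the product space) are conditionally independent given $\mathcal{F}^{\mathbb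 X}_t$; it is anticausal if the same holds with roles exchanged; it is bicausal if it is both. $\mathcal{AW}_p^p(\mathbb X,\mathbb Y):=\inf_\pi\mathbb{E}_\pi[\sum_{t=1}^N|X_t-Y_t|^p]$, the infimum being over bicausal couplings. $\mathrm{FP}_p$ is the set of equivalence classes of $\mathcal{FP}_p$ under $\mathcal{AW}_p(\mathbb X,\mathbb Y)=0$; $v_c$ and $\sim_n$ do not depend on the choice of representatives. $c$ is non-anticipative if $c_t(x):=c(x,t)$ depends only on $(x_1,\dots,x_t)$ for every $1\le t\le N$; continuity of $c$ means continuity of each $c_t$. Adapted functions and rank: the set $\mathrm{AF}$ consists of all (formal) operations $f$, assigning to each filtered process $\mathbb X$ a random variable $f(\mathbb X)$ on $\Omega^{\mathbb X}$, built by finitely many applications of: (AF1) if $\Phi:\mathcal X\to\mathbb{R}$ is continuous and bounded, then $\Phi\in\mathrm{AF}$, $\Phi(\mathbb X):=\Phi(X)$, of rank $0$; (AF2) if $m\in\mathbb N$, $f_1,\dots,f_m\in\mathrm{AF}$ and $\varphi\in C_b(\mathbb{R}^m)$, then $\varphi(f_1,\dots,f_m)\in\mathrm{AF}$, with value $\varphi(f_1(\mathbb X),\dots,f_m(\mathbb X))$ and rank the maximal rank of the $f_i$; (AF3) if $1\le t\le N$ and $g\in\mathrm{AF}$, then $(g|t)\in\mathrm{AF}$, $(g|t)(\mathbb X):=\mathbb{E}[g(\mathbb X)|\mathcal{F}^{\mathbb X}_t]$, with rank that of $g$ plus $1$. $\mathrm{AF}[n]$ is the set of adapted functions of rank at most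 $n$, and $\mathbb X\sim_n\mathbb Y$ means $\mathbb{E}[f(\mathbb X)]=\mathbb{E}[f(\mathbb Y)]$ for all $f\in\mathrm{AF}[n]$. *)

(* Defs.v *)
From HB Require Import structures.
From mathcomp Require Import all_boot all_order all_algebra.
From mathcomp Require Import all_classical all_reals all_analysis.
From mathcomp Require Import measurable_realfun.

Set Implicit Arguments.
Unset Strict Implicit.
Unset Printing Implicit Defensive.

Import Order.TTheory GRing.Theory Num.Theory.
Import numFieldNormedType.Exports.

Local Open Scope classical_set_scope.
Local Open Scope ring_scope.

Definition measurable_wrt (T : Type) (R : realType) (G : set (set T))
    (f : T -> R) : Prop :=
  forall B : set R, measurable B -> G (f @^-1` B).

(* Times 1, ..., N are represented by 'I_N, so time t is the ordinal t - 1. *)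
Record filtered_process (R : realType) (N : nat) : Type := FilteredProcess {
  fp_display : measure_display;
  fp_space : measurableType fp_display;
  fp_prob : probability fp_space R;
  fp_filt : 'I_N -> set (set fp_space);
  fp_proc : 'I_N -> fp_space -> R;
  fp_filt_sigma : forall t, sigma_algebra setT (fp_filt t);
  fp_filt_sub : forall t, fp_filt t `<=` measurable;
  fp_filt_mono : forall s t : 'I_N, (s <= t)%N -> fp_filt s `<=` fp_filt t;
  fp_adapted : forall t, measurable_wrt (fp_filt t) (fp_proc t) }.

Definition fp_path (R : realType) (N : nat) (X : filtered_process R N)
    (w : fp_space X) : 'rV[R]_N :=
  \row_t fp_proc t w.

Definition in_FP (R : realType) (N : nat) (p : R) (X : filtered_process R N) :
    Prop :=
  ('E_(fp_prob X)[fun w => (\sum_(t < N) `|fp_proc t w| `^ p)%R] < +oo)%E.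

Definition is_cond_exp d (T : measurableType d) (R : realType)
    (P : probability T R) (G : set (set T)) (f h : T -> R) : Prop :=
  [/\ measurable_wrt G h,
      P.-integrable setT (EFin \o h) &
      forall A, G A -> (\int[P]_(w in A) (h w)%:E = \int[P]_(w in A) (f w)%:E)%E].

(* Radon-Nikodym on the coarser measurable space. *)
Lemma cond_exp_exists d (T : measurableType d) (R : realType)
    (P : probability T R) (G : set (set T)) (f : T -> R) :
  sigma_algebra setT G -> G `<=` measurable ->
  P.-integrable setT (EFin \o f) -> exists h, is_cond_exp P G f h.
Proof.
move=> sG GT intf.
pose T' : measurableType _ := g_sigma_algebraType G.
have GE (A : set T') : measurable A = G A.
  by rewrite /measurable/= (sigma_algebra_id sG).
have mid : measurable_fun setT (id : T -> T').
  by move=> _ B; rewrite GE setTI; exact: GT.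
pose pid : {mfun T >-> T'} := HB.pack (id : T -> T')
  (isMeasurableFun.Build _ _ _ _ _ mid).
pose mu : probability T' R := distribution P pid.
pose nu : {charge set T' -> \bar R} :=
  measure_function_pushforward__canonical__charge_Charge
    (induced_charge intf) mid.
have numu : nu `<< mu.
  apply: (dominates_pushforward mid).
  apply/null_content_dominatesP => A mA PA; apply: null_set_integral => //.
  exact: (measurable_int P (integrableS measurableT mA _ intf)).
pose g : T' -> \bar R := Radon_Nikodym nu mu.
have gfin x : g x \is a fin_num by exact: Radon_Nikodym_fin_num.
have gint : mu.-integrable setT g by exact: Radon_Nikodym_integrable.
have mg : measurable_fun [set: T'] g by exact: (measurable_int mu gint).
have gE : EFin \o (fine \o g) = g :> (T' -> \bar R).
  by apply/funext => x /=; rewrite fineK.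
have Pg : P.-integrable setT (g : T -> \bar R).
  apply/integrableP; split; first exact: (measurableT_comp mg mid).
  have /integrableP[_] := gint.
  by rewrite ge0_integral_pushforward//; exact: measurableT_comp.
exists (fine \o g); split.
- move=> B mB; rewrite -GE -[X in measurable X]setTI.
  by apply: (measurableT_comp _ mg) => //; exact: measurable_fine.
- by rewrite gE.
- move=> A GA; have mA : measurable (A : set T') by rewrite GE.
  transitivity (\int[P]_(w in A) g w)%E.
    by apply: eq_integral => w _; rewrite /= fineK.
  have := Radon_Nikodym_integral numu mA.
  rewrite -/g integral_pushforward//.
  by apply: (integrableS measurableT _ _ Pg) => //; exact: GT.
Qed.

(* A version of E[f | G]; it is unique only up to a P-null set. *)
Definition cond_exp d (T : measurableType d) (R : realType)
    (P : probability T R) (G : set (set T)) (f : T -> R) : T -> R :=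
  xget (cst 0) [set h | is_cond_exp P G f h].

Inductive AF (R : realType) (N : nat) : Type :=
| AF_base (Phi : 'rV[R]_N -> R) of continuous Phi & bounded_fun Phi
| AF_comp (m : nat) (phi : 'rV[R]_m -> R) of continuous phi & bounded_fun phi &
    ('I_m -> AF R N)
| AF_cond (t : 'I_N) of AF R N.

Fixpoint AF_rank (R : realType) (N : nat) (f : AF R N) : nat :=
  match f with
  | AF_base _ _ _ => 0
  | AF_comp m _ _ _ fs => \max_(i < m) AF_rank (fs i)
  | AF_cond _ g => (AF_rank g).+1
  end.

Fixpoint AF_val (R : realType) (N : nat) (X : filtered_process R N)
    (f : AF R N) : fp_space X -> R :=
  match f with
  | AF_base Phi _ _ => fun w => Phi (fp_path w)
  | AF_comp _ phi _ _ fs => fun w => phi (\row_i AF_val (fs i) w)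
  | AF_cond t g => cond_exp (fp_prob X) (fp_filt t) (AF_val g)
  end.
Arguments AF_val {R N} X f w.

Definition AF_equiv (R : realType) (N n : nat) (X Y : filtered_process R N) :
    Prop :=
  forall f : AF R N, (AF_rank f <= n)%N ->
    ('E_(fp_prob X)[AF_val X f] = 'E_(fp_prob Y)[AF_val Y f])%E.

Definition non_anticipative (R : realType) (N : nat)
    (c : 'rV[R]_N -> 'I_N -> R) : Prop :=
  forall (t : 'I_N) (x y : 'rV[R]_N),
    (forall s : 'I_N, (s <= t)%N -> x ord0 s = y ord0 s) -> c x t = c y t.

Definition stopping_time (R : realType) (N : nat) (X : filtered_process R N)
    (tau : fp_space X -> 'I_N) : Prop :=
  forall t : 'I_N, fp_filt t [set w | (tau w <= t)%N].
Arguments stopping_time {R N} X tau.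

Definition stopping_value (R : realType) (N : nat)
    (c : 'rV[R]_N -> 'I_N -> R) (X : filtered_process R N) : \bar R :=
  ereal_inf [set 'E_(fp_prob X)[fun w => c (fp_path w) (tau w)]
            | tau in stopping_time X]%E.

(* Main.v *)
(* Let b_1, ..., b_N be independent fair bits and let b_0 be a constant bit. At
   time t the bits b_0, ..., b_t are known, and b_{t+1} is known too when b_t is
   true (times are 0, ..., N - 1 here). The process is 1 before the last time
   N - 1, and at time N - 1 it is -2 if b_{N-1} and b_N are both true, and 1
   otherwise. X is this process with b_0 = true, Y with b_0 = false.

   Conditioning on the information at time t averages over the unknown bits, and
   what is averaged over depends only on b_t; hence one conditional expectation
   extends the dependence on the bits by one index downwards, and an adapted
   function of rank r depends only on b_i for i >= N - 1 - r. For r <= N - 2 the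
   bit b_0 is thus invisible.

   For the cost 4^t clip(x_t), the process M_t = 4^t xi_t, with xi_t = -2 if
   b_t and b_{t+1} are true and xi_t = 1 otherwise, lies below the cost and is a
   submartingale whose drift is positive only where b_t is true and b_{t+1}
   false. So every stopping time costs at least E M_0, with equality when b_0 is
   true for the first t such that b_{t+1} is false (or t = N - 1); and E M_0 is 1
   if b_0 is false but less than 1 if b_0 is true. *)
Require Import Defs.
From mathcomp Require Import all_boot all_order all_algebra.
From mathcomp Require Import all_classical all_reals all_analysis.
From mathcomp Require Import measurable_realfun.
From mathcomp Require Import lra zify.
From HB Require Import structures.

Set Implicit Arguments.
Unset Strict Implicit.
Unset Printing Implicit Defensive.

Import Order.TTheory GRing.Theory Num.Theory.
Import numFieldNormedType.Exports.
Local Open Scope classical_set_scope.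
Local Open Scope ring_scope.

(** * The uniform measure on finite sequences of bits *)

(* A type alias: tuples already carry a product sigma-algebra. *)
Definition coins (n : nat) : Type := n.-tuple bool.

HB.instance Definition _ n := Finite.on (coins n).
HB.instance Definition _ n := isPointed.Build (coins n) [tuple of nseq n false].
HB.instance Definition _ n := @isMeasurable.Build default_measure_display
  (coins n) discrete_measurable discrete_measurable0
  (@discrete_measurableC _) (@discrete_measurableU _).

Definition counting_coins (R : realType) n : set (coins n) -> \bar R :=
  msum (fun k => \d_(nth point (enum {: coins n}) k)) #|{: coins n}|.
HB.instance Definition _ (R : realType) n := Measure.on (@counting_coins R n).

Section uniform.
Context (R : realType) (n : nat).
Local Notation T := (coins n).

Fact coins_weight_ge0 : 0 <= (2 ^- n : R). Proof. by []. Qed.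

Definition uniform_coins : set T -> \bar R :=
  mscale (NngNum coins_weight_ge0) (@counting_coins R n).
HB.instance Definition _ := Measure.on uniform_coins.

Lemma uniform_coins1 (w : T) : uniform_coins [set w] = (2 ^- n)%:E.
Proof.
rewrite /uniform_coins /mscale /= /counting_coins /msum cardE.
rewrite -(big_mkord xpredT (fun k => \d_(nth point (enum {: T}) k) [set w])).
rewrite -(big_nth point xpredT (fun v => \d_v [set w])) big_enum /=.
rewrite (bigD1 w) //= big1 ?adde0; last first.
  move=> v vw; rewrite diracE (_ : v \in _ = false) //.
  by apply/negbTE/negP; rewrite inE => vw'; rewrite vw' eqxx in vw.
by rewrite diracE mem_set // mule1.
Qed.

Lemma uniform_coinsT : uniform_coins setT = 1%E.
Proof.
rewrite /uniform_coins /mscale /= /counting_coins /msum.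
rewrite (eq_bigr (fun=> 1%E)) => [|k _]; last by rewrite /= diracE mem_set.
rewrite sumEFin big_const_ord iter_addr_0 card_tuple card_bool natrX -EFinM.
by rewrite mulVf.
Qed.

HB.instance Definition _ := Measure_isProbability.Build _ _ R uniform_coins
  uniform_coinsT.

Lemma integral_coins (A : set T) (f : T -> R) :
  (\int[uniform_coins]_(w in A) (f w)%:E =
   (2 ^- n * \sum_(w : T | w \in A) f w)%:E)%E.
Proof.
have AE : A = \big[setU/set0]_(w <- enum (mem A)) [set w].
  rewrite -bigcup_seq; apply/seteqP; split=> [w Aw|w [v /= vA ->]].
    by exists w => //=; rewrite mem_enum inE.
  by move: vA; rewrite mem_enum inE.
rewrite {1}AE integral_bigsetU_EFin //; last 2 first.
- exact: enum_uniq.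
- by move=> v w _ _ [u [-> ->]].
rewrite mulr_sumr -sumEFin big_enum /=.
apply: eq_bigr => w _.
transitivity (\int[uniform_coins]_(v in [set w]) (cst (f w)%:E) v)%E.
  by apply: eq_integral => v; rewrite inE => ->.
by rewrite integral_cst // [X in (_ * X)%E]uniform_coins1 muleC.
Qed.

Lemma expectation_coins (f : T -> R) :
  ('E_uniform_coins[f] = (2 ^- n * \sum_w f w)%:E)%E.
Proof.
rewrite unlock integral_coins; congr (_ * _)%:E.
by apply: eq_bigl => w; rewrite in_setT.
Qed.

Lemma integrable_coins (f : T -> R) :
  uniform_coins.-integrable setT (EFin \o f).
Proof.
apply/integrableP; split => //.
under eq_integral do rewrite abse_EFin.
by rewrite integral_coins ltry.
Qed.

Lemma is_cond_exp_coins (G : set (set T)) (f h : T -> R) :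
  measurable_wrt G h ->
  (forall A, G A -> \sum_(w | w \in A) h w = \sum_(w | w \in A) f w) ->
  is_cond_exp uniform_coins G f h.
Proof.
move=> Gh fh; split=> [//||A GA]; first exact: integrable_coins.
by rewrite !integral_coins fh.
Qed.

(* Every outcome has positive mass, so versions coincide everywhere. *)
Lemma cond_exp_coins (G : set (set T)) (f h : T -> R) :
  sigma_algebra setT G -> is_cond_exp uniform_coins G f h ->
  cond_exp uniform_coins G f = h.
Proof.
move=> sG hP; rewrite /cond_exp; case: xgetP => [g _ gP|/(_ h)//].
apply/funext => w.
have [[Gg _ gf] [Gh _ hf]] := (gP, hP).
(* On this event of [G] both versions are constant; it has positive mass, so equal integrals give
   [g w = h w]. *)
set A := (g @^-1` [set g w]) `&` (h @^-1` [set h w]).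
have GA : G A.
  have := @measurableI _ (g_sigma_algebraType G)
    (g @^-1` [set g w]) (h @^-1` [set h w]).
  by rewrite measurable_g_measurableTypeE //; apply; [apply: Gg|apply: Gh].
have := gf _ GA; rewrite -hf // !integral_coins => -[].
have n0 : (2 ^- n : R) != 0 by rewrite invr_eq0 expf_neq0.
move=> /(mulfI n0).
rewrite (eq_bigr (fun=> g w)); last by move=> v; rewrite inE => -[].
rewrite [RHS](eq_bigr (fun=> h w)); last by move=> v; rewrite inE => -[].
rewrite !sumr_const -[LHS]mulr_natr -[RHS]mulr_natr => /mulIf; apply.
by rewrite pnatr_eq0 -lt0n; apply/card_gt0P; exists w; rewrite inE.
Qed.

End uniform.

(** * Bits, resampling and the information filtration *)

Section coin_filtration.
Context (n : nat).
Implicit Types (s : bool) (w v : coins n) (t i : nat) (A : set (coins n)).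

(** Index 0 is the constant bit b_0 = [s], index i + 1 is coin i, and indices above [n] default to
    [false]. *)
Definition bit s w i : bool := nth false (s :: w) i.

Lemma bit_default s w i : (n <= i)%N -> bit s w i.+1 = false.
Proof. by move=> ni; rewrite /bit /= nth_default // size_tuple. Qed.

Lemma bit_inj s w v : (forall i, bit s w i.+1 = bit s v i.+1) -> w = v.
Proof.
by move=> wv; apply: eq_from_tnth => i; rewrite !(tnth_nth false); exact: wv.
Qed.

Definition of_bits (f : nat -> bool) : coins n := [tuple f i | i < n].

Lemma bit_of_bits s f i : (i < n)%N -> bit s (of_bits f) i.+1 = f i.
Proof. move=> ni; have := tnth_mktuple (fun i : 'I_n => f i) (Ordinal ni).
by rewrite (tnth_nth false). Qed.

Definition mix (k : pred nat) w v : coins n :=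
  of_bits (fun i => if k i then bit false w i.+1 else bit false v i.+1).

Lemma bit_mix s k w v i :
  bit s (mix k w v) i.+1 = if k i then bit s w i.+1 else bit s v i.+1.
Proof.
by have [ni|ni] := ltnP i n; [rewrite bit_of_bits|rewrite !bit_default ?if_same].
Qed.

(** Here [i] is a coin position and stands for bit i + 1; coin [t] is the one that a true b_t
    reveals early. *)
Definition known s t w i := (i < t)%N || (i == t) && bit s w t.

Definition resample s t w v := mix (known s t w) w v.

Lemma bit_resample_le s t w v i : (i <= t)%N ->
  bit s (resample s t w v) i = bit s w i.
Proof. by case: i => // i it; rewrite bit_mix /known it. Qed.

(** The only random input is bit [t], which resampling keeps. *)
Lemma known_resample s t w v : known s t (resample s t w v) = known s t w.
Proof. by apply/funext => i; rewrite /known bit_resample_le. Qed.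

Lemma known_le s t u w i : (t <= u)%N -> known s t w i -> known s u w i.
Proof.
rewrite /known leq_eqVlt => /predU1P[->//|tu /orP[it|/andP[/eqP-> _]]].
  by rewrite (ltn_trans it).
by rewrite tu.
Qed.

Lemma resample_agree s t w v :
  (forall i, known s t w i -> bit s w i.+1 = bit s v i.+1) ->
  resample s t w v = v.
Proof.
by move=> wv; apply: (@bit_inj s) => i; rewrite bit_mix; case: ifP => // /wv.
Qed.

Lemma resample_resample s t w v u :
  resample s t (resample s t w v) u = resample s t w u.
Proof.
apply: (@bit_inj s) => i; rewrite !bit_mix known_resample.
by case: (known _ _ _ _).
Qed.

(** Events decided by the known coins, encoded as invariance under resampling the others. *)
Definition filt s t : set (set (coins n)) :=
  [set A | forall w v, A (resample s t w v) <-> A w].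

Lemma filt_sigma s t : sigma_algebra setT (filt s t).
Proof.
split=> [//|A FA w v|B FB w v]; first by split=> -[_ nA]; split=> // /FA.
by split=> -[i _ /FB Bi]; exists i => //; apply/FB.
Qed.

Lemma filt_agree s t A w v : filt s t A ->
  (forall i, known s t w i -> bit s w i.+1 = bit s v i.+1) -> A v <-> A w.
Proof. by move=> FA /resample_agree <-. Qed.

Lemma filt_mono s t u : (t <= u)%N -> filt s t `<=` filt s u.
Proof.
move=> tu A FA w v; apply: filt_agree FA _ => i /(known_le tu) k.
by rewrite bit_mix k.
Qed.

Lemma measurable_wrt_filt (R : realType) s t (h : coins n -> R) :
  (forall w v, h (resample s t w v) = h w) -> measurable_wrt (filt s t) h.
Proof. by move=> hr B _ w v; rewrite /= hr. Qed.

(** * Conditional expectation as an average over resampled bits *)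

Section resampling.
Context (R : realType) (s : bool) (t : nat).

Definition average (g : coins n -> R) (w : coins n) : R :=
  2 ^- n * \sum_v g (resample s t w v).

(* Exchanging the unknown coins of [w] and [v] is an involution on pairs. *)
Lemma sum_average (g : coins n -> R) A : filt s t A ->
  \sum_(w | w \in A) average g w = \sum_(w | w \in A) g w.
Proof.
move=> FA.
pose swap (x : coins n * coins n) :=
  (resample s t x.1 x.2, mix (known s t x.1) x.2 x.1).
have swapK : involutive swap.
  move=> [w v]; rewrite /swap /= known_resample; congr pair;
    by apply: (@bit_inj s) => i; rewrite !bit_mix ?known_resample;
    case: (known s t w i).
rewrite /average -mulr_sumr pair_big_dep /= (reindex_inj (inv_inj swapK)) /=.
transitivity (2 ^- n * \sum_(x : coins n * coins n | (x.1 \in A) && true)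
    g x.1 : R).
  congr (_ * _); apply: eq_big => [x|x _].
    rewrite !andbT; apply/idP/idP; rewrite !inE;
      by [exact: (FA _ _).1 | exact: (FA _ _).2].
  exact: (congr1 (g \o fst) (swapK x)).
rewrite -(pair_big_dep (mem A) (fun _ _ => true) (fun w _ => g w)) /=.
rewrite mulr_sumr; apply: eq_bigr => w _.
rewrite sumr_const card_tuple card_bool -[g w *+ _]mulr_natr natrX.
by rewrite mulrC mulfK.
Qed.

Lemma cond_exp_filt (g : coins n -> R) :
  cond_exp (@uniform_coins R n) (filt s t) g = average g.
Proof.
apply: cond_exp_coins; first exact: filt_sigma.
apply: is_cond_exp_coins => [|A]; last exact: sum_average.
apply: measurable_wrt_filt => w v; congr (_ * _).
by apply: eq_bigr => u _; rewrite resample_resample.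
Qed.

End resampling.

(** * The process, and the bits seen by adapted functions *)

Section process.
Context (R : realType) (s : bool).

Definition payoff t w : R := if bit s w t && bit s w t.+1 then - 2 else 1.

(** If b_t is true, b_{t+1} is known at time [t]; if b_t is false, the payoff is 1 in any case. *)
Lemma payoff_resample t w v : payoff t (resample s t w v) = payoff t w.
Proof.
rewrite /payoff bit_resample_le //; case: ifP => /andP.
  case=> bt; rewrite bit_mix /known eqxx bt orbT => bt1.
  by rewrite bt1.
case: (boolP (bit s w t)) => // bt; rewrite bit_mix /known eqxx bt orbT.
by case: (bit s w t.+1) => // -[].
Qed.

Definition coin_proc (t : 'I_n) w : R := if t.+1 == n then payoff t w else 1.

Lemma coin_proc_adapted (t : 'I_n) : measurable_wrt (filt s t) (coin_proc t).
Proof.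
apply: measurable_wrt_filt => w v; rewrite /coin_proc.
by rewrite payoff_resample.
Qed.

Definition coin_process : filtered_process R n :=
  @FilteredProcess R n _ (coins n) (@uniform_coins R n)
    (fun t : 'I_n => filt s t) coin_proc
    (fun t : 'I_n => filt_sigma s t) (fun (t : 'I_n) _ _ => I)
    (fun t u : 'I_n => @filt_mono s t u) coin_proc_adapted.

End process.

(** Induction on [f]: the path involves only bits n - 1 and n, and under a conditioning both sides
    are averaged over the same [v]. *)
Lemma AF_val_coin_process (R : realType) (f : AF R n) s s' w w' :
  (forall i, (n.-1 - AF_rank f <= i)%N -> bit s w i = bit s' w' i) ->
  AF_val (coin_process R s) f w = AF_val (coin_process R s') f w'.
Proof.
elim: f s s' w w' => [Phi _ _|m phi _ _ fs IH|t g IH] s s' w w' /= ww'.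
- congr Phi; apply/rowP => t; rewrite !mxE /= /coin_proc /payoff.
  case: eqP => // /(congr1 predn) /= tn.
  by rewrite !ww' // subn0 -tn ?leqnSn.
- congr phi; apply/rowP => j; rewrite !mxE; apply: IH => i ij; apply: ww'.
  apply: leq_trans ij; apply: leq_sub2l.
  exact: (@leq_bigmax _ (fun j => AF_rank (fs j))).
- rewrite !cond_exp_filt; congr (_ * _); apply: eq_bigr => v _.
  apply: IH => -[|i] ij.
    by rewrite !bit_resample_le //; apply: ww'; lia.
  rewrite !bit_mix /known.
  have [it|//|it] /= := ltngtP i t; first by apply: ww'; lia.
  (* Bit t + 1 is kept or resampled according to b_t: this costs the one extra index. *)
  by rewrite it -!ww' //; lia.
Qed.

(** * Optional stopping for the weighted payoffs *)

Section stopping.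
Context (R : realType) (s : bool).
Local Notation payoff := (payoff R s).

Definition flip (j : nat) w : coins n :=
  of_bits (fun i => bit false w i.+1 (+) (i == j)).

Lemma bit_flip j w i : (j < n)%N ->
  bit s (flip j w) i.+1 = bit s w i.+1 (+) (i == j).
Proof.
move=> jn; have [ni|ni] := ltnP i n; first by rewrite bit_of_bits.
by rewrite !bit_default // gtn_eqF // (leq_trans jn).
Qed.

Lemma bit_flip_neq j w i : (j < n)%N -> i != j.+1 ->
  bit s (flip j w) i = bit s w i.
Proof.
by case: i => // i jn; rewrite eqSS bit_flip // => /negbTE->; rewrite addbF.
Qed.

Lemma flipK j : (j < n)%N -> involutive (flip j).
Proof.
by move=> jn w; apply: (@bit_inj s) => i; rewrite !bit_flip // addbK.
Qed.

Lemma sum_involution A (f : coins n -> coins n) (H : coins n -> R) :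
  involutive f -> (forall w, A (f w) <-> A w) ->
  \sum_(w | w \in A) H (f w) = \sum_(w | w \in A) H w.
Proof.
move=> fK fA; rewrite [RHS](reindex_inj (inv_inj fK)) /=; apply: eq_bigl => w.
by apply/idP/idP; rewrite !inE => /fA.
Qed.

(* Average over the unseen bits: b_{t+2}, then b_{t+1} when b_t is false. *)
Lemma sum_payoff_step t A : (t.+1 < n)%N -> filt s t A ->
  \sum_(w | w \in A) 4 * payoff t.+1 w = \sum_(w | w \in A)
    (payoff t w + (if bit s w t && ~~ bit s w t.+1 then 3 else 0)).
Proof.
move=> tn FA; have tn' := ltnW tn.
(* Coin t + 1 is never known at time [t], so flipping it preserves [A]. If b_{t+1} is true, the
   values -2 and 1 average to -1/2, and the factor 4 restores -2. *)
have step1 : \sum_(w | w \in A) 4 * payoff t.+1 w =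
    \sum_(w | w \in A) (if bit s w t.+1 then - 2 else 4).
  apply: (@mulrI _ 2); first by rewrite unitfE.
  rewrite mulr_natl mulr2n -[X in X + _](@sum_involution _ (flip t.+1));
    last 2 first.
  - exact: flipK.
  - move=> w; apply: filt_agree FA _ => i k; rewrite bit_flip_neq // !eqSS.
    by case/orP: k => [/ltnW|/andP[/eqP-> _]]; lia.
  rewrite -big_split /= mulr_sumr; apply: eq_bigr => w _.
  rewrite /payoff [bit _ _ t.+1]bit_flip_neq ?[bit _ _ t.+2]bit_flip ?eqxx //;
    last by lia.
  by case: (bit s w t.+1); case: (bit s w t.+2) => /=; lra.
rewrite step1; 
apply: (@mulrI _ 2); first by rewrite unitfE.
(* Flip b_{t+1} only where it is unknown: there -2 and 4 average to the payoff 1. Where b_t is true,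
   the excess over the payoff is 0 or 3. *)
pose f w := if bit s w t then w else flip t w.
have ft w : bit s (f w) t = bit s w t.
  by rewrite /f; case: ifP => // bt; rewrite bit_flip_neq ?bt ?ltn_eqF.
rewrite mulr_natl mulr2n -[X in X + _](@sum_involution _ f); last 2 first.
- by move=> w; rewrite {1}/f ft /f; case: (bit s w t); rewrite ?flipK.
- move=> w; apply: filt_agree FA _ => i k.
  rewrite /f; case: ifPn => // bt; rewrite bit_flip_neq // eqSS.
  by move: k; rewrite /known (negbTE bt) andbF orbF => /ltn_eqF->.
rewrite -big_split /= mulr_sumr; apply: eq_bigr => w _.
rewrite /payoff /f; case: (boolP (bit s w t)) => bt.
  by case: (bit s w t.+1) => /=; lra.
by rewrite bit_flip // eqxx; case: (bit s w t.+1) => /=; lra.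
Qed.

(** The double sum is the drift in the Doob decomposition of M, accumulated until [tau]. *)
Lemma sum_payoff_stop (tau : coins n -> 'I_n) : (0 < n)%N ->
  @stopping_time R n (coin_process R s) tau ->
  \sum_w 4 ^+ tau w * payoff (tau w) w = \sum_w payoff 0 w +
    \sum_(0 <= t < n.-1) \sum_(w | (t < tau w)%N)
      4 ^+ t * (if bit s w t && ~~ bit s w t.+1 then 3 else 0).
Proof.
move=> n0 stau.
(* Induction on the truncation level; at k = n - 1 the truncation is void. *)
suff H k : (k < n)%N ->
    \sum_w 4 ^+ minn (tau w) k * payoff (minn (tau w) k) w = \sum_w payoff 0 w +
    \sum_(0 <= t < k) \sum_(w | (t < tau w)%N)
      4 ^+ t * (if bit s w t && ~~ bit s w t.+1 then 3 else 0).
  rewrite -H ?prednK //; apply: eq_bigr => w _.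
  by rewrite (minn_idPl _) // -ltnS prednK.
elim: k => [|k IH] kn.
  rewrite big_nil addr0; apply: eq_bigr => w _.
  by rewrite minn0 expr0 mul1r.
rewrite big_nat_recr //= addrA -IH; last exact: ltnW.
(* Only outcomes not yet stopped change from k to k + 1, and they form an event of time k. *)
pose A := [set w | (k < tau w)%N].
have FA : filt s k A.
  have -> : A = ~` [set w | (tau w <= k)%N].
    by apply/seteqP; split=> w; rewrite /A /= ltnNge => /negP.
  have [_ FC _] := filt_sigma s k.
  by rewrite -setTD; apply: FC; exact: (stau (Ordinal (ltnW kn))).
rewrite !(bigID (fun w => (k < tau w)%N) predT) /= -addrA.
rewrite [X in _ = _ + X]addrC addrA.
congr (_ + _); last first.
  apply: eq_bigr => w; rewrite -leqNgt => wk.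
  by rewrite !(minn_idPl _) // leqW.
rewrite -big_split /=.
have toA (F : coins n -> R) :
    \sum_(w : coins n | (k < tau w)%N) F w = \sum_(w | w \in A) F w.
  by apply: eq_bigl => w; rewrite /A; apply/idP/idP; rewrite inE.
rewrite !toA; transitivity (4 ^+ k * \sum_(w | w \in A) 4 * payoff k.+1 w).
  rewrite mulr_sumr; apply: eq_bigr => w; rewrite inE => kw.
  by rewrite (minn_idPr _) // exprSr mulrA.
rewrite (sum_payoff_step kn FA) mulr_sumr; apply: eq_bigr => w.
by rewrite inE => kw; rewrite (minn_idPr (ltnW kw)) mulrDr.
Qed.
End stopping.

(** * The cost and its optimal value for the two processes *)

Section optimal_stopping.
Context (R : realType) (s : bool).
Local Notation payoff := (payoff R s).
Local Notation X := (coin_process R s).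

(** Clipping to [-2, 1] gives boundedness and leaves the values of the process unchanged. *)
Definition cost (x : 'rV[R]_n) (t : 'I_n) : R :=
  4 ^+ t * Num.max (- 2) (Num.min 1 (x ord0 t)).

Lemma cost_bounded : bounded_fun (uncurry cost).
Proof.
exists (4 ^+ n * 2); split; first exact: num_real.
move=> M nM [x t] _ /=; apply: le_trans (ltW nM).
rewrite /cost normrM ger0_norm ?exprn_ge0 //; apply: ler_pM => //.
  by apply: ler_weXn2l; [lra|exact: ltnW].
by rewrite ler_norml le_max lexx /= ge_max ge_min; lra.
Qed.

Lemma cost_continuous (t : 'I_n) : continuous (cost ^~ t).
Proof.
move=> x; apply: (@continuous_comp _ _ _ (fun x : 'rV[R]_n => x ord0 t)
  (fun y => 4 ^+ t * Num.max (- 2) (Num.min 1 y))).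
  exact: coord_continuous.
have clip_continuous :
    continuous ((cst (- 2) : R -> R^o) \max ((cst 1 : R -> R^o) \min id)).
  move=> y; apply: continuous_max; first exact: cvg_cst.
  by apply: continuous_min; [exact: cvg_cst|exact: cvg_id].
by apply: cvgM; [exact: cvg_cst|exact: clip_continuous].
Qed.

Lemma cost_non_anticipative : non_anticipative cost.
Proof. by move=> t x y xy; rewrite /cost xy. Qed.

Lemma cost_path (w : coins n) (t : 'I_n) :
  cost (fp_path (X := X) w) t =
  4 ^+ t * (if t.+1 == n then payoff t w else 1).
Proof.
rewrite /cost mxE /= /coin_proc /payoff; congr (_ * _).
have le21 : - 2 <= 1 :> R by lra.
case: (t.+1 == n); last by rewrite minxx max_r.
by case: ifP => _; [rewrite min_r // maxxx|rewrite minxx max_r].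
Qed.

Lemma payoff_le_cost (w : coins n) (t : 'I_n) :
  4 ^+ t * payoff t w <= cost (fp_path (X := X) w) t.
Proof.
rewrite cost_path ler_wpM2l ?exprn_ge0 //.
by case: ifP => // _; rewrite /payoff; case: ifP => // _; lra.
Qed.

Lemma in_FP_coin_process (p : R) : in_FP p X.
Proof. by rewrite /in_FP expectation_coins ltry. Qed.

End optimal_stopping.

(** With b_0 false the initial payoff is identically 1, and the drift is nonnegative. *)
Lemma stopping_value_false (R : realType) : (0 < n)%N ->
  (1 <= stopping_value (@cost R) (coin_process R false))%E.
Proof.
move=> n0; apply: le_ereal_inf_tmp => _ [tau stau <-].
rewrite expectation_coins lee_fin mulrC ler_pdivlMr ?exprn_gt0 // mul1r.
apply: le_trans (ler_sum _ (fun w _ => payoff_le_cost R false w (tau w))).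
rewrite (sum_payoff_stop n0 stau) (eq_bigr (fun=> 1)) //.
rewrite sumr_const card_tuple card_bool natrX lerDl.
apply: sumr_ge0 => t _; apply: sumr_ge0 => w _.
by rewrite mulr_ge0 ?exprn_ge0 //; case: ifP.
Qed.

Lemma stopping_value_true (R : realType) : (0 < n)%N ->
  (stopping_value (@cost R) (coin_process R true) < 1)%E.
Proof.
move=> n0.
(* If the first n - 1 coins are all true, [find] returns n - 1, the last time. *)
pose first w := find negb (take n.-1 w).
have first_lt w : (first w < n)%N.
  rewrite -[X in (_ < X)%N](prednK n0) ltnS (leq_trans (find_size _ _)) //.
  by rewrite size_take; case: ifP => //; rewrite size_tuple; lia.
pose tau w : 'I_n := Ordinal (first_lt w).
have tau_max w : (tau w <= n.-1)%N by rewrite -ltnS prednK // ltn_ord.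
have tau_ge w t : (t < tau w)%N -> bit true w t.+1.
  move=> tw; have tn := leq_trans tw (tau_max w).
  by have := before_find false tw; rewrite nth_take // => /negbFE.
have tau_stop w : (tau w < n.-1)%N -> bit true w (tau w).+1 = false.
  move=> tn; have sz : size (take n.-1 w) = n.-1.
    by rewrite size_takel // size_tuple leq_pred.
  have : has negb (take n.-1 w) by rewrite has_find sz.
  by move/(nth_find false); rewrite nth_take // => /negbTE.
have tauP w t : (t < n.-1)%N ->
    (t < tau w)%N <-> (forall i, (i <= t)%N -> bit true w i.+1).
  move=> tn; split=> [tw i it|wt]; first exact/tau_ge/(leq_ltn_trans it).
  rewrite ltnNge; apply/negP => wt'.
  by have := tau_stop w (leq_ltn_trans wt' tn); rewrite wt.
have stau : @stopping_time R n (coin_process R true) tau.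
  move=> t w v; have [tn|tn] := ltnP t n.-1; last first.
    by split=> _; exact: leq_trans (tau_max _) tn.
  have eqb : bit true w t -> forall i, (i <= t)%N ->
      bit true (resample true t w v) i.+1 = bit true w i.+1.
    by move=> bt i it; rewrite bit_mix /known bt andbT orbC -leq_eqVlt it.
  (* At [t = 0] this uses that b_0 is true; a true b_t makes b_{t+1} visible at time [t], so [tau]
     may look ahead. *)
  have last_bit x : (forall i, (i <= t)%N -> bit true x i.+1) -> bit true x t.
    by case: (val t) => // j xt; apply: xt.
  suff eq_lt : (t < tau (resample true t w v))%N = (t < tau w)%N.
    by rewrite /mkset leqNgt eq_lt -leqNgt.
  apply/idP/idP => /(tauP _ _ tn) wt; apply/(tauP _ _ tn) => i it.
    rewrite -eqb ?wt // -(bit_resample_le true w v (leqnn t)).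
    exact: last_bit.
  by rewrite eqb ?wt //; exact: last_bit.
apply: le_lt_trans (ereal_inf_lbound _) _; first by exists tau.
rewrite expectation_coins lte_fin mulrC ltr_pdivrMr ?exprn_gt0 // mul1r.
(* Stopping before the last time means b_{tau+1} is false, so the payoff is 1 and equals the
   unweighted cost. *)
rewrite (eq_bigr (fun w => 4 ^+ tau w * payoff R true (tau w) w)); last first.
  move=> w _; rewrite cost_path; case: eqP => // tn; congr (_ * _).
  rewrite /payoff tau_stop ?andbF // -ltnS prednK // ltn_neqAle.
  apply/andP; split.
    exact/eqP.
  exact: ltn_ord.
rewrite (sum_payoff_stop n0 stau) [X in _ + X]big_nat.
rewrite [X in _ + X]big1 ?addr0; last first.
  by move=> t tn; apply: big1 => w /tau_ge ->; rewrite andbF mulr0.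
have -> : 2 ^+ n = \sum_(w : coins n) 1 :> R.
  by rewrite sumr_const card_tuple card_bool natrX.
(* Strictness comes from the all-true outcome, whose initial payoff is -2. *)
pose w1 : coins n := of_bits xpredT.
rewrite (bigD1 w1) // [ltRHS](bigD1 w1) //=; apply: ltr_leD.
  by rewrite /payoff bit_of_bits //=; lra.
by apply: ler_sum => w _; rewrite /payoff; case: ifP => // _; lra.
Qed.
End coin_filtration.

Theorem theorem7p1 (R : realType) (N : nat) (hN : (2 <= N)%N)
    (p : R) (hp : 1 <= p) :
  exists X Y : filtered_process R N,
    [/\ in_FP p X, in_FP p Y, AF_equiv (N - 2) X Y &
      exists c : 'rV[R]_N -> 'I_N -> R,
        [/\ bounded_fun (uncurry c),
            (forall t : 'I_N, continuous (c ^~ t)),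
            non_anticipative c &
            stopping_value c X <> stopping_value c Y]].
Proof.
exists (coin_process N R true), (coin_process N R false).
split; [exact: in_FP_coin_process|exact: in_FP_coin_process| |].
  move=> f fN; rewrite !expectation_coins; congr (_ * _)%:E.
  (* Since N - 1 - (N - 2) = 1, index 0 is out of reach; all other bits coincide. *)
  apply: eq_bigr => w _; apply: AF_val_coin_process => -[|//].
  by lia.
exists (@cost N R); split; [exact: cost_bounded|exact: cost_continuous|
  exact: cost_non_anticipative|].
have N0 : (0 < N)%N by exact: ltnW.
move=> eqv; have := stopping_value_false R N0.
by rewrite -eqv leNgt stopping_value_true.
Qed.
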